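(* Let $\mathcal{K}=\mathcal{K}^1\times\cdots\times\mathcal{K}^r\subseteq\mathbb{R}^n$ be a product of closed convex cones, let $\mathcal{A}:\mathbb{R}^n\to\mathbb{R}^m$ be linear, $b\in\mathbb{R}^m$ and $c\in\mathbb{R}^n$. (i) (D) is not strongly infeasible if and only if there are: (a) a sequence of reducing directions $\{d_1, \ldots , d_\ell\}$ for $(\mathrm{P}_{\text{feas}})$ restoring strong duality, with $\ell = d_{\text{str}}(\mathrm{P}_{\text{feas}})$, and (b) $\hat y$ such that $c - \mathcal{A}^* \hat y \in (\mathcal{K}^*\cap \{d_1\}^\perp \cap \cdots \cap \{d_\ell\}^\perp)^*$. (ii) If (D) is not strongly infeasible, there is an affine subspace $\mathcal{V}' \subseteq c - \mathrm{range}\, \mathcal{A}^*$ such that $(\mathcal{V}', \mathcal{K})$ is not strongly infeasible and the dimension of $\mathcal{V}'$ satisfies $$\dim(\mathcal{V}') \leq d_{\text{str}}(\mathrm{P}_{\text{feas}}) \leq \sum_{i=1}^{r} \ell_{\text{poly}}((\mathcal{K}^i)^* ).$$ In particular, if (D) is weakly infeasible, then $(\mathcal{V}', \mathcal{K})$ is weakly infeasible.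
   Context: $\mathcal{K}^*$ denotes the dual cone and $\mathcal{A}^*$ the adjoint of $\mathcal{A}$. Problem (D) is $\sup\{\langle b,y\rangle : c-\mathcal{A}^*y\in\mathcal{K}\}$. For an affine subspace $\mathcal{V}$, $(\mathcal{V},\mathcal{K})$ denotes the feasibility problem of finding a point in $\mathcal{V}\cap\mathcal{K}$. It is strongly infeasible if $\mathrm{dist}(\mathcal{V},\mathcal{K})>0$, and weakly infeasible if $\mathcal{V}\cap\mathcal{K}=\emptyset$ but $\mathrm{dist}(\mathcal{V},\mathcal{K})=0$. (D) is strongly/weakly infeasible if $(c+\mathrm{range}\,\mathcal{A}^*,\mathcal{K})$ is. $(\mathrm{P}_{\text{feas}})$ is the problem $\inf\{\langle c,x\rangle : \mathcal{A}x=0,\ x\in\mathcal{K}^*\}$, with dual $(\mathrm{D}_{\text{feas}})$: $\sup\{0 : c-\mathcal{A}^*y\in\mathcal{K}\}$. The optimal values are $\theta_{\mathrm{P}_{\text{feas}}}$ and $\theta_{\mathrm{D}_{\text{feas}}}$; the value of an infeasible inf-problem is $+\infty$ and of an infeasible sup-problem is $-\infty$. A sequence of reducing directions (facial reduction steps) for $(\mathrm{P}_{\text{feas}})$ is a sequence $d_1,\dots,d_\ell$ with $d_i\in\mathcal{F}_i^*\cap\mathrm{range}\,\mathcal{A}^*$, where $\mathcal{F}_1=\mathcal{K}^*$ and $\mathcal{F}_{i+1}=\mathcal{F}_i\cap\{d_i\}^\perp$. It restores strong duality if, with $(\hat{\mathrm{D}})$ denoting the problem $\sup\{0 : c-\mathcal{A}^*y\in\mathcal{F}_{\ell+1}^*\}$,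 one has $\theta_{\mathrm{P}_{\text{feas}}}=\theta_{\hat{\mathrm{D}}}$, and moreover $\theta_{\hat{\mathrm{D}}}$ is attained when $-\infty<\theta_{\mathrm{P}_{\text{feas}}}<+\infty$. The distance to strong duality $d_{\text{str}}(\mathrm{P}_{\text{feas}})$ is the minimum length $\ell$ ($\ell=0$ allowed) of a sequence of reducing directions for $(\mathrm{P}_{\text{feas}})$ that restores strong duality. The distance to polyhedrality $\ell_{\text{poly}}(\mathcal{C})$ of a nonempty closed convex cone $\mathcal{C}$ is the length minus one of the longest strictly ascending chain of nonempty faces $\mathcal{F}_1\subsetneq\cdots\subsetneq\mathcal{F}_\ell$ of $\mathcal{C}$ (length $\ell$) such that $\mathcal{F}_1$ is polyhedral and $\mathcal{F}_j$ is not polyhedral for all $j>1$. *)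

(* Defs.v *)
From mathcomp Require Import all_boot all_order all_algebra.
From mathcomp Require Import all_classical all_reals all_analysis.

Set Implicit Arguments.
Unset Strict Implicit.
Unset Printing Implicit Defensive.

Import Order.TTheory GRing.Theory Num.Theory.
Import numFieldNormedType.Exports.

Local Open Scope classical_set_scope.
Local Open Scope ring_scope.

Section Geometry.
Context {R : realType}.
Implicit Types n : nat.

Definition dot n (u v : 'cV[R]_n) : R := \sum_(i < n) u i 0 * v i 0.

(* The Euclidean norm; the library norm on matrices is the sup norm. *)
Definition enorm n (u : 'cV[R]_n) : R := Num.sqrt (dot u u).

(* inf over the empty set is +oo, so dist(V, K) = +oo if V or K is empty. *)
Definition edistance n (V K : set 'cV[R]_n) : \bar R :=
  ereal_inf [set (enorm (z.1 - z.2))%:E | z in V `*` K].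

(* A cone contains the origin, hence is nonempty. *)
Definition closed_convex_cone n (K : set 'cV[R]_n) : Prop :=
  [/\ closed K,
      K 0,
      forall x y, K x -> K y -> K (x + y) &
      forall (t : R) x, 0 <= t -> K x -> K (t *: x)].

Definition dual_cone n (K : set 'cV[R]_n) : set 'cV[R]_n :=
  [set s | forall x, K x -> 0 <= dot s x].

Definition orth n (d : 'cV[R]_n) : set 'cV[R]_n := [set x | dot d x = 0].

Definition prod_cone (r : nat) (p : 'I_r -> nat)
    (K : forall i, set 'cV[R]_(p i)) : set 'cV[R]_(\sum_(i < r) p i) :=
  [set x | forall i, K i (submxcol x i)].

Definition polyhedral n (C : set 'cV[R]_n) : Prop :=
  exists (k : nat) (a : 'I_k -> 'cV[R]_n) (beta : 'I_k -> R),
    C = [set x | forall i, dot (a i) x <= beta i].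

Definition face n (C F : set 'cV[R]_n) : Prop :=
  [/\ F `<=` C,
      forall x y (t : R), F x -> F y -> 0 <= t <= 1 ->
        F (t *: x + (1 - t) *: y) &
      forall x y (t : R), C x -> C y -> 0 < t < 1 ->
        F (t *: x + (1 - t) *: y) -> F x /\ F y].

(* The chain F 0 `<` ... `<` F l.-1; only the first l values of F matter. *)
Definition poly_chain n (C : set 'cV[R]_n) (l : nat)
    (F : nat -> set 'cV[R]_n) : Prop :=
  [/\ forall j, (j < l)%N -> face C (F j) /\ F j !=set0,
      forall j, (j.+1 < l)%N -> F j `<` F j.+1,
      polyhedral (F 0%N) &
      forall j, (0 < j < l)%N -> ~ polyhedral (F j)].

Definition ell_poly n (C : set 'cV[R]_n) : \bar R :=
  ereal_sup [set (l.-1)%:R%:E | l in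
    [set l : nat | (0 < l)%N /\ exists F, poly_chain C l F]].

Definition strongly_infeasible n (V K : set 'cV[R]_n) : Prop :=
  (0 < edistance V K)%E.

Definition weakly_infeasible n (V K : set 'cV[R]_n) : Prop :=
  V `&` K = set0 /\ edistance V K = 0%E.

(* a + L, a nonempty affine subspace of dimension \dim L. *)
Definition affine_subspace n (a : 'cV[R]_n) (L : {vspace 'cV[R]_n}) :
    set 'cV[R]_n :=
  [set a + u | u in [set` L]].

End Geometry.

(* A linear map is given by its matrix A, acting as x |-> A *m x; its adjoint
   is then y |-> A^T *m y. *)
Section Problems.
Context {R : realType} {m n : nat}.
Variables (K : set 'cV[R]_n) (A : 'M[R]_(m, n)) (c : 'cV[R]_n).

Definition range_adj : set 'cV[R]_n := [set A^T *m y | y in setT].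

Definition D_strongly_infeasible : Prop :=
  strongly_infeasible [set c + u | u in range_adj] K.

Definition D_weakly_infeasible : Prop :=
  weakly_infeasible [set c + u | u in range_adj] K.

Definition theta_Pfeas : \bar R :=
  ereal_inf [set (dot c x)%:E | x in [set x | A *m x = 0] `&` dual_cone K].

(* ds lists d_1, ..., d_l; fr_face ds is F_{l+1}. *)
Definition fr_face (ds : seq 'cV[R]_n) : set 'cV[R]_n :=
  foldl (fun F d => F `&` orth d) (dual_cone K) ds.

Definition reducing_directions (ds : seq 'cV[R]_n) : Prop :=
  forall i, (i < size ds)%N ->
    dual_cone (fr_face (take i ds)) ds`_i /\ range_adj ds`_i.

Definition Dhat_feasible (ds : seq 'cV[R]_n) : set 'cV[R]_m :=
  [set y | dual_cone (fr_face ds) (c - A^T *m y)].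

Definition theta_Dhat (ds : seq 'cV[R]_n) : \bar R :=
  ereal_sup [set 0%E | y in Dhat_feasible ds].

Definition restores_strong_duality (ds : seq 'cV[R]_n) : Prop :=
  theta_Pfeas = theta_Dhat ds /\
  ((-oo < theta_Pfeas < +oo)%E ->
     exists2 y, Dhat_feasible ds y & theta_Dhat ds = 0%E).

(* The minimal length, as an extended real (+oo if there is no sequence). *)
Definition d_str : \bar R :=
  ereal_inf [set (size ds)%:R%:E | ds in
    [set ds | reducing_directions ds /\ restores_strong_duality ds]].

End Problems.

(* Main.v *)
(* Write C for the dual cone of K and L for the range of A^T. By separation,
   (D) is not strongly infeasible iff c lies in the dual of C cut by the
   orthogonal of L, iff the value of (P_feas) is 0. For minimal reducing
   directions ds restoring strong duality, (D^) is then feasible at some y, and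
   the same equivalence, with the span of ds in place of L, shows that
   c - A^T y + span ds is not strongly infeasible. For the bound on d_str, as
   long as the partial polyhedral Slater condition fails, there is a reducing
   direction cutting a nonpolyhedral block strictly, which happens at most
   ell_poly times per block. Once it holds, c lies in F^* + L for the current
   face F of C.

   The duality statements avoid topology: F is cut by directions d of L one at a
   time, with (F cut by d)^* included in F^* + R d, either because d takes both
   signs on F (completeness of R) or because d is nonnegative on F and vanishes
   on its nonpolyhedral blocks (Farkas). Separation itself is an instance. *)
Require Import Defs.
From mathcomp Require Import all_boot all_order all_algebra.
From mathcomp Require Import all_classical all_reals all_analysis.
From mathcomp Require Import ring lra.

Import Order.TTheory GRing.Theory Num.Theory.
Import numFieldNormedType.Exports.

Local Open Scope classical_set_scope.
Local Open Scope ring_scope.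

(** * Euclidean inner product and norm *)

Section Cones.
Set Implicit Arguments.
Unset Strict Implicit.
Context {R : realType}.

Section Dot.
Context {n : nat}.
Implicit Types u v w : 'cV[R]_n.

Lemma dotC u v : dot u v = dot v u.
Proof. by apply: eq_bigr => i _; rewrite mulrC. Qed.

Lemma dotDl u v w : dot (u + v) w = dot u w + dot v w.
Proof. by rewrite -big_split; apply: eq_bigr => i _; rewrite mxE mulrDl. Qed.

Lemma dotZl t u v : dot (t *: u) v = t * dot u v.
Proof. by rewrite mulr_sumr; apply: eq_bigr => i _; rewrite mxE mulrA. Qed.

Lemma dotDr u v w : dot w (u + v) = dot w u + dot w v.
Proof. by rewrite dotC dotDl !(dotC w). Qed.

Lemma dotZr t u v : dot u (t *: v) = t * dot u v.
Proof. by rewrite dotC dotZl dotC. Qed.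

Lemma dotNl u v : dot (- u) v = - dot u v.
Proof. by rewrite -scaleN1r dotZl mulN1r. Qed.

Lemma dotNr u v : dot u (- v) = - dot u v.
Proof. by rewrite dotC dotNl dotC. Qed.

Lemma dot0l v : dot 0 v = 0.
Proof. by rewrite -(scale0r 0) dotZl mul0r. Qed.

Lemma dot0r v : dot v 0 = 0.
Proof. by rewrite dotC dot0l. Qed.

Definition dotE := (dotDl, dotDr, dotNl, dotNr, dotZl, dotZr, dot0l, dot0r).

Lemma dot_mulmx u v : dot u v = (u^T *m v) 0 0.
Proof. by rewrite mxE; apply: eq_bigr => i _; rewrite mxE. Qed.

Lemma dot_ge0 u : 0 <= dot u u.
Proof. by apply: sumr_ge0 => i _; rewrite -expr2 sqr_ge0. Qed.

Lemma dot_eq0 u : dot u u = 0 -> u = 0.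
Proof.
move/eqP; rewrite psumr_eq0 => [/allP h|i _]; last by rewrite -expr2 sqr_ge0.
apply/matrixP => i j; rewrite (ord1 j) mxE.
by have /eqP := h i (mem_index_enum _); move/eqP; rewrite mulf_eq0 orbb => /eqP.
Qed.

Lemma dot_CauchySchwarz u v : dot u v ^+ 2 <= dot u u * dot v v.
Proof.
have [/dot_eq0 ->|v0] := eqVneq (dot v v) 0; first by rewrite !dotE expr0n mulr0.
have vv : 0 < dot v v by rewrite lt_def v0 dot_ge0.
have := dot_ge0 (dot v v *: u - dot u v *: v).
rewrite !dotE (dotC v u) => h.
by rewrite -(ler_pM2l vv); lra.
Qed.

Lemma enorm_ge0 u : 0 <= enorm u.
Proof. exact: sqrtr_ge0. Qed.

Lemma enorm_sqr u : enorm u ^+ 2 = dot u u.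
Proof. by rewrite sqr_sqrtr ?dot_ge0. Qed.

Lemma dot_le_enorm u v : dot u v <= enorm u * enorm v.
Proof.
apply: le_trans (ler_norm _) _.
rewrite -sqrtrM ?dot_ge0 // -sqrtr_sqr ler_wsqrtr //.
exact: dot_CauchySchwarz.
Qed.

Lemma enormD u v : enorm (u + v) <= enorm u + enorm v.
Proof.
rewrite -(@ler_pXn2r _ 2) ?nnegrE ?addr_ge0 ?enorm_ge0 //.
rewrite enorm_sqr !dotE (dotC v u) sqrrD !enorm_sqr.
have := dot_le_enorm u v; lra.
Qed.

Lemma enormZ t u : 0 <= t -> enorm (t *: u) = t * enorm u.
Proof.
by move=> t0; rewrite /enorm !dotE mulrA -expr2 sqrtrM ?sqr_ge0 // sqrtr_sqr ger0_norm.
Qed.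

Lemma enormN u : enorm (- u) = enorm u.
Proof. by rewrite /enorm !dotE opprK. Qed.

Lemma enorm0 : enorm (0 : 'cV[R]_n) = 0.
Proof. by rewrite /enorm dot0l sqrtr0. Qed.

End Dot.

(** * Convex cones: duals of sections, separation and Farkas *)

Definition cone n (F : set 'cV[R]_n) : Prop :=
  [/\ F 0, forall x y, F x -> F y -> F (x + y) &
      forall (t : R) x, 0 <= t -> F x -> F (t *: x)].

Definition linear_subspace n (L : set 'cV[R]_n) : Prop :=
  [/\ L 0, forall x y, L x -> L y -> L (x + y) &
      forall (t : R) x, L x -> L (t *: x)].

Definition perp n (L : set 'cV[R]_n) : set 'cV[R]_n :=
  [set x | forall u, L u -> dot u x = 0].

Section Duality.
Context {n : nat}.
Implicit Types (F L M : set 'cV[R]_n) (c d s u x : 'cV[R]_n).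

Lemma linear_subspaceN L u : linear_subspace L -> L u -> L (- u).
Proof. by case=> _ _ LZ Lu; rewrite -scaleN1r; apply: LZ. Qed.

Lemma cone_orth F d : cone F -> cone (F `&` orth d).
Proof.
move=> [F0 FD FZ]; split=> [|x y [Fx dx] [Fy dy]|t x t0 [Fx dx]].
- by split=> //; rewrite /orth /= dot0r.
- by split; [exact: FD | rewrite /orth /= dotDr dx dy addr0].
- by split; [exact: FZ | rewrite /orth /= dotZr dx mulr0].
Qed.

Lemma dual_cone_cone F : cone (dual_cone F).
Proof.
split=> [x _|s s' Fs Fs' x Fx|t s t0 Fs x Fx]; rewrite !dotE //.
- by rewrite addr_ge0 ?Fs ?Fs'.
- by rewrite mulr_ge0 ?Fs.
Qed.

(** Decreasing measure for the inductions on successive cuts: the codimension of the span of the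
    directions used so far. *)
Lemma codim_addv_line (W : {vspace 'cV[R]_n}) d :
  d \notin W -> (n - \dim (W + <[d]>) < n - \dim W)%N.
Proof.
move=> dW; have ltd : (\dim W < \dim (W + <[d]>))%N.
  have /ltn_leqif -> := dimv_leqif_eq (addvSl W <[d]>).
  apply: contra dW => /eqP ->; rewrite -{1}[d]add0r memv_add ?mem0v //.
  exact: memv_line.
have len : (\dim (W + <[d]>) <= n)%N.
  by rewrite (leq_trans (dimvS (subvf _))) // dimvf dim_matrix mulr1.
by rewrite ltn_sub2l // (leq_trans ltd).
Qed.

(* Each cut is by a direction not vanishing on [F], hence outside the span of
   the previous ones, so at most [n] cuts occur. *)
Lemma dual_cone_perp (good : set (set 'cV[R]_n)) L : linear_subspace L ->
    (forall F, good F ->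
      (forall c, dual_cone (F `&` perp L) c ->
         exists2 u, L u & dual_cone F (c - u)) \/
      exists d, [/\ L d, exists2 x, F x & dot d x <> 0, good (F `&` orth d) &
         forall s, dual_cone (F `&` orth d) s ->
           exists t, dual_cone F (s + t *: d)]) ->
  forall F, good F -> forall c, dual_cone (F `&` perp L) c ->
  exists2 u, L u & dual_cone F (c - u).
Proof.
move=> [L0 LD LZ] step.
suff main k (W : {vspace 'cV[R]_n}) F : (n - \dim W < k)%N ->
    (forall w, w \in W -> forall x, F x -> dot w x = 0) -> good F ->
    forall c, dual_cone (F `&` perp L) c -> exists2 u, L u & dual_cone F (c - u).
  move=> F gF; apply: (main n.+1 0%VS F _ _ gF) => [|w].
    by rewrite dimv0 subn0.
  by rewrite memv0 => /eqP -> x _; rewrite dot0l.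
elim: k W F => [//|k IH] W F lek WF gF c Fc.
have [|[d [Ld [x Fx dx] gF' sF']]] := step F gF; first exact.
have dW : d \notin W by apply/negP => /WF /(_ x Fx).
have [||||u Lu Fu] := IH (W + <[d]>)%VS (F `&` orth d) _ _ _ c.
- by rewrite -ltnS (leq_trans _ lek) // ltnS codim_addv_line.
- move=> w /memv_addP[w1 w1W [w2 /vlineP[t ->] ->]] y [Fy dy].
  by rewrite !dotE (WF _ w1W) // dy mulr0 addr0.
- by [].
- move=> y [[Fy dy] Ly]; exact: Fc.
have [t Ft] := sF' _ Fu.
exists (u - t *: d); last by rewrite opprB addrA addrAC.
by apply: LD => //; rewrite -scaleNr; apply: LZ.
Qed.

(* A suitable [t] is the supremum of [- <s, x> / <d, x>] over the [x] in [F]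
   with [0 < <d, x>]. *)
Lemma dual_cone_orth_indefinite F d s : cone F ->
    (exists2 x, F x & 0 < dot d x) -> (exists2 x, F x & dot d x < 0) ->
  dual_cone (F `&` orth d) s -> exists t, dual_cone F (s + t *: d).
Proof.
move=> [F0 FD FZ] [x0 Fx0 dx0] [y0 Fy0 dy0] Fs.
pose E := [set - dot s x / dot d x | x in F `&` [set x | 0 < dot d x]].
have ub y : F y -> dot d y < 0 -> ubound E (dot s y / - dot d y).
  move=> Fy dy _ [x [Fx /= dx] <-].
  (* This combination of [x] and [y] lies in [F] cut by [orth d], where [s] is nonnegative. *)
  have : 0 <= dot s (- dot d y *: x + dot d x *: y).
    apply: Fs; split; first by apply: FD; apply: FZ => //; lra.
    by rewrite /orth /= !dotE; ring.
  rewrite ler_pdivrMr // mulrAC ler_pdivlMr ?oppr_gt0 // !dotE; lra.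
have E0 : E !=set0 by exists (- dot s x0 / dot d x0); exists x0.
exists (sup E) => x Fx; rewrite !dotE.
have [dx|dx|dx] := ltgtP (dot d x) 0.
- have := ge_sup E0 (ub _ Fx dx); rewrite ler_pdivlMr ?oppr_gt0 //; lra.
- have /ub_le_sup : has_ubound E by exists (dot s y0 / - dot d y0); exact: ub.
  move=> /(_ (- dot s x / dot d x)); rewrite ler_pdivrMr //.
  have Ex : E (- dot s x / dot d x) by exists x.
  by move=> /(_ Ex); lra.
- by rewrite dx mulr0 addr0; apply: Fs.
Qed.

(** The hypothesis is the dual form of Slater's condition. Every [d] in [L] that does not vanish on
    [F] then takes both signs there, so it can be cut off. The condition survives the cut, since a
    functional nonnegative on the cut becomes nonnegative on [F] after adding a multiple of [d]. *)
Lemma dual_cone_perp_lineal F L c : cone F -> linear_subspace L ->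
    (forall d x, dual_cone F d -> L d -> F x -> dot d x = 0) ->
  dual_cone (F `&` perp L) c -> exists2 u, L u & dual_cone F (c - u).
Proof.
move=> cF sL FL; have [L0 LD LZ] := sL.
apply: (@dual_cone_perp [set F | cone F /\
  forall d x, dual_cone F d -> L d -> F x -> dot d x = 0] L sL) => //.
move=> {}F {cF FL c} [cF FL].
have [[d Ld [x Fx dx]]|nex] :=
    pselect (exists2 d, L d & exists2 x, F x & dot d x <> 0); last first.
  left=> c Fc; exists 0 => // x Fx; rewrite subr0; apply: Fc; split=> // u Lu.
  by apply: contrapT => ux; apply: nex; exists u => //; exists x.
right.
have pos e : L e -> dot e x <> 0 -> exists2 y, F y & dot e y < 0.
  move=> Le ex; apply: contrapT => npos; apply: ex; apply: (FL e) => //.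
  by move=> y Fy; rewrite leNgt; apply/negP => ey; apply: npos; exists y.
have orthF s : dual_cone (F `&` orth d) s -> exists t, dual_cone F (s + t *: d).
  apply: dual_cone_orth_indefinite => //; last exact: pos.
  have [||y Fy] := pos (- d); first exact: linear_subspaceN.
    by rewrite dotNl; lra.
  by rewrite dotNl => ?; exists y => //; lra.
exists d; split => //; first by exists x.
split; first exact: cone_orth.
move=> e y /orthF[t Fe] Le [Fy dy].
by have := FL _ y Fe (LD _ _ Le (LZ t _ Ld)) Fy; rewrite !dotE dy mulr0 addr0.
Qed.

(* With [L] the hyperplane orthogonal to [c] and [F] the cone generated by [M]
   and a ball around [- c], the functional [- c] is nonnegative on [F] cut by
   [perp L]; its extension separates. *)
Lemma cone_separation M c e : cone M -> 0 < e ->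
  (forall y, M y -> e <= enorm (c - y)) ->
  exists2 s, dual_cone M s & dot s c < 0.
Proof.
move=> [M0 MD MZ] e0 far.
have c0 : 0 < dot c c.
  rewrite -enorm_sqr exprn_gt0 // (lt_le_trans e0) //.
  by rewrite -[X in enorm X]subr0; exact: far.
pose F := [set x | exists m t, [/\ M m, 0 <= t & enorm (x - m + t *: c) <= t * (e / 2)]].
have cF : cone F.
  split=> [|x y [m [t [Mm t0 h]]] [m' [t' [Mm' t'0 h']]]|a x a0 [m [t [Mm t0 h]]]].
  - by exists 0, 0; split=> //; rewrite subr0 scale0r addr0 mul0r enorm0.
  - exists (m + m'), (t + t'); split; [exact: MD | exact: addr_ge0 |].
    have -> : x + y - (m + m') + (t + t') *: c =
      (x - m + t *: c) + (y - m' + t' *: c).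
      by apply/matrixP => i j; rewrite !mxE; ring.
    by apply: (le_trans (enormD _ _)); rewrite mulrDl lerD.
  - exists (a *: m), (a * t); split; [exact: MZ | exact: mulr_ge0 |].
    by rewrite -scalerA -scalerBr -scalerDr enormZ // -mulrA ler_wpM2l.
have MF x : M x -> F x.
  by move=> Mx; exists x, 0; split=> //; rewrite subrr scale0r addr0 enorm0 mul0r.
have ball v : enorm v <= e / 2 -> F (- c + v).
  move=> h; exists 0, 1; split=> //.
  by rewrite subr0 scale1r addrAC addNr add0r mul1r.
(* Otherwise [c] would be within [e / 2] of the point [(1 + t)^-1 *: m] of [M]. *)
have cNF : ~ F c.
  move=> [m [t [Mm t0 h]]].
  have t1 : 0 < 1 + t by lra.
  have := far _ (MZ (1 + t)^-1 _ (ltW _) Mm); rewrite invr_gt0 => /(_ t1).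
  rewrite -(ler_pM2l t1) -enormZ ?(ltW t1) // scalerBr scalerA mulfV ?gt_eqF //.
  rewrite scale1r scalerDl scale1r addrAC => h'.
  by have := le_trans h' h; rewrite mulrDl; nra.
pose L := [set d | dot d c = 0].
have sL : linear_subspace L.
  split=> [|x y|t x]; rewrite /L /= !dotE // => ->; first by move=> ->; rewrite addr0.
  by rewrite mulr0.
have [||u Lu Fu] := @dual_cone_perp_lineal F L (- c) cF sL.
(* A nonzero [d] orthogonal to [c] is negative somewhere on the ball around [- c]. *)
- move=> d x Fd Ld _; suff -> : d = 0 by rewrite dot0l.
  apply: dot_eq0; apply/eqP; rewrite eq_le dot_ge0 andbT leNgt; apply/negP => d0.
  have nd : 0 < enorm d by rewrite sqrtr_gt0.
  have := Fd (- c + (- (e / 2 / enorm d)) *: d).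
  rewrite !dotE Ld oppr0 add0r mulNr oppr_ge0 => h.
  have /h : F (- c + (- (e / 2 / enorm d)) *: d).
    apply: ball; rewrite scaleNr enormN enormZ; last first.
      by rewrite divr_ge0 ?enorm_ge0 //; lra.
    by rewrite mulfVK ?gt_eqF.
  by rewrite leNgt; apply/negP/negPn; rewrite mulr_gt0 // divr_gt0 //; lra.
(* The component [w] of [x] is in [L], so [x] is orthogonal to it and is a multiple of [c]; [cNF]
   excludes a positive multiple. *)
- move=> x [Fx Lx]; pose w := x - (dot c x / dot c c) *: c.
  have cw : dot w c = 0.
    by rewrite /w !dotE (dotC x c) mulfVK ?subrr ?gt_eqF.
  have xE : x = (dot c x / dot c c) *: c.
    apply/eqP; rewrite -subr_eq0 -/w; apply/eqP; apply: dot_eq0.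
    by rewrite {2}/w dotDr dotNr dotZr cw Lx //; ring.
  rewrite dotNl oppr_ge0 leNgt; apply/negP => cx; apply: cNF.
  have cE : (dot c c / dot c x) *: x = c.
    rewrite [X in _ *: X]xE scalerA -[RHS]scale1r; congr (_ *: _).
    by field; rewrite !gt_eqF.
  rewrite -cE; case: cF => _ _; apply=> //; by rewrite divr_ge0 ?ltW.
exists (- c - u); first by move=> x /MF; apply: Fu.
by rewrite !dotE Lu; lra.
Qed.

(** Membership in the cone generated by [as_], with the coefficients chosen one at a time to fit an
    induction that eliminates generators. *)
Fixpoint conic_comb (as_ : seq 'cV[R]_n) (s : 'cV[R]_n) : Prop :=
  if as_ is a :: as' then exists2 l, 0 <= l & conic_comb as' (s - l *: a) else s = 0.

Lemma conic_le0 as_ s x : conic_comb as_ s ->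
  (forall a, a \in as_ -> dot a x <= 0) -> dot s x <= 0.
Proof.
elim: as_ s => [|a as_ IH] s /=; first by move=> ->; rewrite dot0l.
move=> [l l0 h] ax; have := IH _ h (fun b bs => ax b (@mem_behead _ (a :: as_) b bs)).
have : l * dot a x <= 0 by rewrite mulr_ge0_le0 ?ax ?mem_head.
by rewrite !dotE; lra.
Qed.

(** Undoes the elimination of [a]: each [b] contributes the coefficient [- dot b y] of [a], which is
    nonnegative, so the total only grows from [r]. *)
Lemma conic_shift (as_ : seq 'cV[R]_n) (a y s : 'cV[R]_n) (r : R) :
    (forall b, b \in as_ -> dot b y <= 0) ->
    conic_comb [seq b - dot b y *: a | b <- as_] (s - r *: a) ->
  exists2 l, r <= l & conic_comb as_ (s - l *: a).
Proof.
elim: as_ s r => [|b as_ IH] s r /= asy; first by exists r.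
move=> [l l0 h].
have [||l' ll' h'] := IH (s - l *: b) (r - l * dot b y).
- by move=> b' b's; rewrite asy // inE b's orbT.
- by congr (conic_comb _ _): h; apply/matrixP => i j; rewrite !mxE; ring.
exists l'.
  have := mulr_ge0_le0 l0 (asy b (mem_head _ _)); lra.
by exists l => //; congr (conic_comb _ _): h'; rewrite addrAC.
Qed.

(* Bartl's induction: if [s] is not already a consequence of the other
   inequalities, a witness [y] of this is used to eliminate [a]. *)
Lemma farkas (as_ : seq 'cV[R]_n) s :
    (forall x, (forall a, a \in as_ -> dot a x <= 0) -> dot s x <= 0) ->
  conic_comb as_ s.
Proof.
have [k lek] := ubnP (size as_); elim: k as_ s lek => // k IH [|a as_] s lek hs.
  apply: dot_eq0; apply/eqP; rewrite eq_le dot_ge0 andbT; exact: hs.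
have [h|/existsNP[y /not_implyP[asy /negP sy]]] :=
    pselect (forall x, (forall a, a \in as_ -> dot a x <= 0) -> dot s x <= 0).
  by exists 0; rewrite ?lexx // scale0r subr0; apply: IH.
rewrite -ltNge in sy.
have ay : 0 < dot a y.
  rewrite ltNge; apply/negP => ay; have : dot s y <= 0; last by lra.
  by apply: hs => b; rewrite inE => /predU1P[->//|/asy].
wlog ay1 : y asy sy ay / dot a y = 1.
  move=> /(_ ((dot a y)^-1 *: y)); apply; rewrite ?dotZr ?mulVf ?gt_eqF //.
  - move=> b /asy; rewrite dotZr => h.
    by rewrite mulr_ge0_le0 // invr_ge0 ltW.
  - by rewrite mulr_gt0 // invr_gt0.
have : conic_comb [seq b - dot b y *: a | b <- as_] (s - dot s y *: a).
  apply: IH; first by rewrite size_map.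
  (* Projecting [x] along [y] onto [orth a] is the transpose of the elimination; the projected point
     satisfies all the inequalities. *)
  move=> x h; have -> : dot (s - dot s y *: a) x = dot s (x - dot a x *: y).
    by rewrite !dotE; ring.
  apply: hs => b; rewrite inE => /predU1P[->|bs].
    by rewrite !dotE ay1; lra.
  by have := h _ (map_f _ bs); rewrite !dotE; lra.
by case/(conic_shift asy) => l hl h; exists l => //; lra.
Qed.

(** Every [beta i] can be replaced by 0: it is nonnegative because the origin satisfies the
    inequalities, and a functional positive somewhere on a cone is unbounded above on it. *)
Lemma polyhedral_coneE F : cone F -> polyhedral F ->
  exists as_ : seq 'cV[R]_n, F = [set x | forall a, a \in as_ -> dot a x <= 0].
Proof.
move=> [F0 _ FZ] [k [a [beta FE]]]; exists [seq a i | i <- enum 'I_k].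
apply/seteqP; split=> x /=; last first.
  move=> h; move: F0; rewrite FE /= => h0 i.
  have := h0 i; rewrite dot0r; apply: le_trans.
  by apply: h; apply: map_f; rewrite mem_enum.
move=> Fx _ /mapP[i _ ->]; rewrite leNgt; apply/negP => ax.
have : F ((`|beta i| + 1) / dot (a i) x *: x).
  by apply: FZ => //; rewrite divr_ge0 ?addr_ge0 // ltW.
rewrite FE /= => /(_ i); rewrite dotZr mulfVK ?gt_eqF // => h.
by have := ler_norm (beta i); lra.
Qed.

(** As [d] is nonnegative on [F], the single inequality [dot d x <= 0] describes the cut, so Farkas
    writes [- s] with a coefficient [t] on [d]. *)
Lemma dual_cone_orth_polyhedral F d s : cone F -> polyhedral F ->
    dual_cone F d -> dual_cone (F `&` orth d) s ->
  exists t, dual_cone F (s + t *: d).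
Proof.
move=> cF /(polyhedral_coneE cF)[as_ FE] Fd Fs.
have [x xas|t t0 h] := @farkas (d :: as_) (- s).
  rewrite dotNl oppr_le0; apply: Fs.
  have Fx : F x by rewrite FE => a aas; apply: xas; rewrite inE aas orbT.
  split=> //; rewrite /orth /=; apply/eqP; rewrite eq_le Fd // andbT.
  by apply: xas; rewrite mem_head.
exists t => x; rewrite FE => Fx; have := conic_le0 h Fx.
by rewrite !dotE; lra.
Qed.

End Duality.
End Cones.

(** * Faces, polyhedrality and chains of nonpolyhedral faces *)

Section Faces.
Set Implicit Arguments.
Unset Strict Implicit.
Context {R : realType} {n : nat}.
Implicit Types (C F L : set 'cV[R]_n) (d x : 'cV[R]_n).

Lemma polyhedral_seq (s : seq ('cV[R]_n * R)) :
  polyhedral [set x | forall ab, ab \in s -> dot ab.1 x <= ab.2].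
Proof.
exists (size s), (fun i => (tnth (in_tuple s) i).1), (fun i => (tnth (in_tuple s) i).2).
apply/seteqP; split=> x /= h; first by move=> i; apply: h; exact: mem_tnth.
by move=> ab abs; have /tnthP[i ->] : ab \in in_tuple s by []; exact: h.
Qed.

Lemma polyhedral_orth F d : polyhedral F -> polyhedral (F `&` orth d).
Proof.
move=> [k [a [beta ->]]].
have := polyhedral_seq ([:: (d, 0); (- d, 0)] ++ [seq (a i, beta i) | i <- enum 'I_k]).
congr polyhedral; apply/seteqP; split=> x.
  move=> h; split=> [i|].
    by apply: (h (a i, beta i)); rewrite mem_cat map_f ?orbT // mem_enum.
  have h1 := h (d, 0); have h2 := h (- d, 0).
  apply/eqP; rewrite eq_le; apply/andP; split.
    by apply: h1; rewrite mem_cat inE eqxx.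
  by rewrite -oppr_le0 -dotNl; apply: h2; rewrite mem_cat !inE eqxx orbT.
move=> [h hd] ab; rewrite mem_cat !inE => /orP[/orP[]/eqP ->|/mapP[i _ ->]] /=.
- by rewrite hd.
- by rewrite dotNl hd oppr0.
- exact: h.
Qed.

(** A matrix of maximal rank with rows in [L] has row space [L]; the columns of its cokernel are
    then equations of [L], each split into two inequalities. *)
Lemma subspace_polyhedral L : linear_subspace L -> polyhedral L.
Proof.
move=> [L0 LD LZ].
have Lsum (I : Type) (r : seq I) (v : I -> 'cV[R]_n) :
    (forall i, L (v i)) -> L (\sum_(i <- r) v i).
  by move=> Lv; apply: (big_ind L).
pose P k := `[< exists2 M : 'M[R]_n, (forall i, L (row i M)^T) & \rank M = k >].
have Lmul (M : 'M[R]_n) (u : 'rV[R]_n) : (forall i, L (row i M)^T) -> L (u *m M)^T.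
  move=> LM; rewrite mulmx_sum_row linear_sum; apply: Lsum => i.
  by rewrite linearZ /=; apply: LZ; apply: LM.
have P0 : exists k, P k.
  exists 0%N; apply/asboolP; exists 0; rewrite ?mxrank0 //.
  by move=> i; rewrite row0 trmx0.
have ubP k : P k -> (k <= n)%N by move=> /asboolP[M _ <-]; exact: rank_leq_row.
case: (ex_maxnP P0 ubP) => _ /asboolP[M LM <-] maxM.
have LE x : L x <-> (x^T <= M)%MS.
  split=> [Lx|/submxP[u xE]]; last by rewrite -[x]trmxK xE; exact: Lmul.
  have := mxrank_leqif_sup (addsmxSl M x^T); rewrite addsmx_sub submx_refl /= => h.
  rewrite -(geq_leqif h); apply: maxM; apply/asboolP; exists (M + x^T)%MS => // i.
  have /sub_addsmxP[[u v] /= ->] := row_sub i (M + x^T)%MS.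
  rewrite linearD /=; apply: LD; first exact: Lmul.
  by rewrite trmx_mul trmxK [v^T]mx11_scalar mul_mx_scalar; apply: LZ.
pose K := cokermx M.
have KE x j : dot (col j K) x = (x^T *m K) 0 j.
  by rewrite mxE; apply: eq_bigr => i _; rewrite !mxE mulrC.
have := polyhedral_seq ([seq (col j K, 0) | j <- enum 'I_n] ++
                        [seq (- col j K, 0) | j <- enum 'I_n]).
congr polyhedral; apply/seteqP; split=> x.
  move=> h; apply/LE; rewrite submxE; apply/eqP/matrixP => i j.
  rewrite (ord1 i) -KE mxE; apply/eqP; rewrite eq_le; apply/andP; split.
    by apply: (h (col j K, 0)); rewrite mem_cat map_f // mem_enum.
  rewrite -oppr_le0 -dotNl; apply: (h (- col j K, 0)).
  by rewrite mem_cat orbC map_f // mem_enum.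
move=> /LE; rewrite submxE => /eqP Kx ab.
by rewrite mem_cat => /orP[]/mapP[j _ ->] /=; rewrite ?dotNl KE Kx mxE ?oppr0.
Qed.

Lemma face_refl C : cone C -> face C C.
Proof.
move=> [_ CD CZ]; split=> // x y t Cx Cy /andP[t0 t1].
by apply: CD; apply: CZ => //; lra.
Qed.

Lemma face_orth C F d : face C F -> dual_cone F d -> face C (F `&` orth d).
Proof.
move=> [FC Fconv Fext] Fd; split=> [x [/FC //]|x y t [Fx dx] [Fy dy] t01|].
  by split; [exact: Fconv | rewrite /orth /= !dotE dx dy !mulr0 addr0].
move=> x y t Cx Cy t01 [Fxy dxy].
have [Fx Fy] := Fext x y t Cx Cy t01 Fxy.
case/andP: t01 => t0 t1; move: dxy; rewrite /orth /= !dotE => dxy.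
have dx := Fd x Fx; have dy := Fd y Fy.
by split; split=> //; rewrite /orth /=; nra.
Qed.

(** For a cone, the smallest face containing the origin. Being a subspace it is polyhedral, so it
    can be the bottom of a chain for [ell_poly]. *)
Definition lineality C : set 'cV[R]_n := [set x | C x /\ C (- x)].

Lemma subspace_lineality C : cone C -> linear_subspace (lineality C).
Proof.
move=> [C0 CD CZ]; split=> [|x y [Cx Cx'] [Cy Cy']|t x [Cx Cx']].
- by split=> //; rewrite oppr0.
- by rewrite /lineality /= opprD; split; apply: CD.
have [t0|t0] := leP 0 t; first by split; rewrite -?scalerN; apply: CZ.
have -> : t *: x = - t *: - x by rewrite scalerN scaleNr opprK.
by split; rewrite -?scalerN ?opprK; apply: CZ => //; lra.
Qed.

Lemma face_lineality C : cone C -> face C (lineality C).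
Proof.
move=> cC; have [C0 CD CZ] := cC; have [_ LD LZ] := subspace_lineality cC.
split=> [x [] //|x y t Lx Ly _|]; first by apply: LD; exact: LZ.
have half x y t : C x -> C y -> 0 < t < 1 -> C (- (t *: x + (1 - t) *: y)) -> C (- x).
  move=> Cx Cy /andP[t0 t1] Cxy.
  have -> : - x = t^-1 *: (- (t *: x + (1 - t) *: y) + (1 - t) *: y).
    by rewrite opprD addrNK scalerN scalerA mulVf ?gt_eqF ?scale1r.
  apply: (CZ); first by rewrite invr_ge0 ltW.
  by apply: CD => //; apply: CZ => //; lra.
move=> x y t Cx Cy t01 [_ Cxy]; split; split=> //; first exact: half t01 Cxy.
apply: (half y x (1 - t)) => //; first by lra.
by rewrite subKr addrC.
Qed.

Lemma face_sub_lineality C F : cone C -> face C F -> F 0 -> lineality C `<=` F.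
Proof.
move=> [C0 CD CZ] [FC _ Fext] F0 x [Cx Cx'].
have [] // := Fext x (- x) (1 / 2) Cx Cx'; first by lra.
suff -> : 1 / 2 *: x + (1 - 1 / 2) *: - x = 0 by [].
by apply/matrixP => i j; rewrite !mxE; field.
Qed.

(** Records [k] nonpolyhedral faces left behind by facial reduction, all strictly above the current
    [F]. Whether [F] is polyhedral is left open, since reduction may still go on. *)
Definition nonpoly_chain C F (k : nat) : Prop :=
  exists G : nat -> set 'cV[R]_n,
    [/\ forall j, (j < k)%N -> face C (G j) /\ ~ polyhedral (G j),
        forall j, (j.+1 < k)%N -> G j `<` G j.+1 &
        (0 < k)%N -> F `<` G 0%N].

Lemma nonpoly_chain0 C F : nonpoly_chain C F 0.
Proof. by exists (fun=> setT). Qed.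

Lemma nonpoly_chain_sub C F F' k :
  F' `<=` F -> nonpoly_chain C F k -> nonpoly_chain C F' k.
Proof.
move=> F'F [G [Gface Gchain FG]]; exists G; split=> // /FG[FG0 nFG0].
by split=> [x /F'F /FG0 //|h]; apply: nFG0 => x /h /F'F.
Qed.

Lemma nonpoly_chainS C F F' k : face C F -> ~ polyhedral F -> F' `<` F ->
  nonpoly_chain C F k -> nonpoly_chain C F' k.+1.
Proof.
move=> fF nF F'F [G [Gface Gchain FG]].
by exists (fun j => if j is j'.+1 then G j' else F); split=> // [[|j]|[|j]] //;
  [exact: Gface | exact: Gchain].
Qed.

Lemma nonpoly_chain_ell_poly_polyhedral C F k : face C F -> F 0 -> polyhedral F ->
  nonpoly_chain C F k -> (k%:R%:E <= ell_poly C)%E.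
Proof.
move=> fF F0 pF [G [Gface Gchain FG]]; apply: ereal_sup_ubound.
(* Putting [F] at the bottom makes [k.+1] faces, and [ell_poly] subtracts one. *)
exists k.+1 => //; split=> //; exists (fun j => if j is j'.+1 then G j' else F).
have proper_ne (A B : set 'cV[R]_n) : A `<` B -> B !=set0.
  by move=> [_ nBA]; apply/set0P/eqP => B0; apply: nBA; rewrite B0.
split=> // [[|j] jk|[|j] jk|[|j] jk] //.
- by split=> //; exists 0.
- split; first by have [] := Gface j jk.
  case: j jk => [|j] jk; first exact: proper_ne (FG _).
  exact: proper_ne (Gchain j _).
- exact: FG.
- exact: Gchain.
- by have [] := Gface j jk.
Qed.

(** A nonpolyhedral [F] joins the chain itself, with the lineality space as the new bottom; this
    even gives [k.+1]. *)
Lemma nonpoly_chain_ell_poly C F k : cone C -> face C F -> F 0 ->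
  nonpoly_chain C F k -> (k%:R%:E <= ell_poly C)%E.
Proof.
move=> cC fF F0 Fk; have [pF|nF] := pselect (polyhedral F).
  exact: nonpoly_chain_ell_poly_polyhedral Fk.
have pL := subspace_polyhedral (subspace_lineality cC).
have LF := face_sub_lineality cC fF F0.
have [L0 _ _] := subspace_lineality cC.
have /(nonpoly_chain_ell_poly_polyhedral (face_lineality cC) L0 pL) :
    nonpoly_chain C (lineality C) k.+1.
  apply: (nonpoly_chainS fF nF _ Fk); split=> // FL; apply: nF.
  by have -> : F = lineality C by apply/seteqP; split.
by apply: le_trans; rewrite lee_fin ler_nat.
Qed.

End Faces.

(** * Duality in products of cones *)

Section Products.
Set Implicit Arguments.
Unset Strict Implicit.
Context {R : realType} {r : nat} {p : 'I_r -> nat}.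
Implicit Types (F : forall i, set 'cV[R]_(p i)) (d s x : 'cV[R]_(\sum_(i < r) p i)).

Lemma dot_submxcol (x y : 'cV[R]_(\sum_(i < r) p i)) :
  dot x y = \sum_i dot (submxcol x i) (submxcol y i).
Proof.
rewrite dot_mulmx -{1}[x]submxcolK -{1}[y]submxcolK tr_mxcol mul_mxrow_mxcol summxE.
by apply: eq_bigr => i _; rewrite dot_mulmx.
Qed.

Lemma cone_prod F : (forall i, cone (F i)) -> cone (prod_cone F).
Proof.
move=> cF; split=> [i|x y Fx Fy i|t x t0 Fx i]; have [F0 FD FZ] := cF i.
- by rewrite submxcol0.
- by rewrite submxcolD; exact: FD.
- suff -> : submxcol (t *: x) i = t *: submxcol x i by exact: FZ.
  by apply/matrixP => j k; rewrite !mxE.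
Qed.

Lemma dual_cone_prod F : (forall i, F i 0) ->
  dual_cone (prod_cone F) = prod_cone (fun i => dual_cone (F i)).
Proof.
move=> F0; apply/seteqP; split=> s Fs; last first.
  by move=> x Fx; rewrite dot_submxcol sumr_ge0 // => i _; apply: Fs.
move=> i x Fx; pose f := dfwith (fun j => 0 : 'cV[R]_(p j)) i x.
have := Fs (\mxcol_j f j); rewrite dot_submxcol (bigD1 i) //= big1 => [|j ji].
  rewrite mxcolK /f dfwithin addr0; apply=> j; rewrite mxcolK.
  have [<-|ij] := eqVneq i j; first by rewrite dfwithin.
  by rewrite dfwithout.
by rewrite mxcolK /f dfwithout ?dot0r // eq_sym.
Qed.

(** A sum of nonnegative terms vanishes only termwise, so a reducing direction cuts each block
    separately. *)
Lemma prod_cone_orth F d : (forall i, F i 0) -> dual_cone (prod_cone F) d ->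
  prod_cone F `&` orth d = prod_cone (fun i => F i `&` orth (submxcol d i)).
Proof.
move=> F0; rewrite dual_cone_prod // => Fd; apply/seteqP; split=> x.
  move=> [Fx] /eqP; rewrite dot_submxcol psumr_eq0 => [/allP dx i|i _]; last exact: Fd.
  by split=> //; apply/eqP; apply: dx; rewrite mem_index_enum.
move=> Fx; split=> [i|]; first by have [] := Fx i.
by rewrite /orth /= dot_submxcol big1 // => i _; have [] := Fx i.
Qed.

Lemma dual_cone_prod_orth F d s : (forall i, cone (F i)) ->
    dual_cone (prod_cone F) d ->
    (forall i, polyhedral (F i) \/ forall y, F i y -> dot (submxcol d i) y = 0) ->
    dual_cone (prod_cone F `&` orth d) s ->
  exists t, dual_cone (prod_cone F) (s + t *: d).
Proof.
move=> cF; have F0 i : F i 0 by have [] := cF i.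
move=> Fd Fpoly; rewrite prod_cone_orth // dual_cone_prod => [Fs|i]; last first.
  by split=> //; rewrite /orth /= dot0r.
rewrite dual_cone_prod // in Fd *.
have /choice[t Ft] i : exists t, dual_cone (F i) (submxcol s i + t *: submxcol d i).
  case: (Fpoly i) => [pF|dF]; first exact: dual_cone_orth_polyhedral (Fs i).
  exists 0; rewrite scale0r addr0 => x Fx; apply: (Fs i x); split=> //.
  exact: dF.
(* As [d] is nonnegative on every block, enlarging its coefficient is harmless: one bound for all
   the [t i] serves every block. *)
exists (\sum_i `|t i|) => i x Fx.
have -> : submxcol (s + (\sum_i `|t i|) *: d) i =
    submxcol s i + (\sum_i `|t i|) *: submxcol d i.
  by apply/matrixP => j k; rewrite !mxE.
have ti : t i <= \sum_i `|t i|.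
  rewrite (bigD1 i) //=; apply: (le_trans (ler_norm _)).
  by rewrite lerDl sumr_ge0.
have := Ft i x Fx; have := Fd i x Fx; rewrite !dotE; nra.
Qed.

(* The partial polyhedral Slater condition, in dual form. *)
Lemma dual_cone_prod_perp F L c : (forall i, cone (F i)) -> linear_subspace L ->
    (forall i, polyhedral (F i) \/
       forall d y, dual_cone (prod_cone F) d -> L d -> F i y ->
         dot (submxcol d i) y = 0) ->
    dual_cone (prod_cone F `&` perp L) c ->
  exists2 u, L u & dual_cone (prod_cone F) (c - u).
Proof.
move=> cF sL Fpoly; have [L0 LD LZ] := sL.
apply: (@dual_cone_perp _ _ [set G | exists F, [/\ G = prod_cone F,
  forall i, cone (F i) & forall i, polyhedral (F i) \/
  forall d y, dual_cone G d -> L d -> F i y -> dot (submxcol d i) y = 0]] L sL);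
  last by exists F.
move=> G {cF Fpoly F c} [F [-> cF Fpoly]].
have F0 i : F i 0 by have [] := cF i.
have [[d [Fd Ld] [x Fx dx]]|nex] := pselect (exists2 d,
  dual_cone (prod_cone F) d /\ L d & exists2 x, prod_cone F x & dot d x <> 0); last first.
  left=> c; apply: dual_cone_perp_lineal => //; first exact: cone_prod.
  move=> d x Fd Ld Fx; apply: contrapT => dx; apply: nex.
  by exists d => //; exists x.
right; exists d.
have sF s : dual_cone (prod_cone F `&` orth d) s ->
    exists t, dual_cone (prod_cone F) (s + t *: d).
  apply: dual_cone_prod_orth => // i; case: (Fpoly i) => [|dF]; [by left|right].
  by move=> y Fy; apply: dF.
split=> //; first by exists x.
exists (fun i => F i `&` orth (submxcol d i)); split.
- exact: prod_cone_orth.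
- by move=> i; exact: cone_orth.
move=> i; case: (Fpoly i) => [pF|dF]; [left; exact: polyhedral_orth|right].
move=> e y /sF[t Fe] Le [Fy dy].
have := dF _ y Fe (LD _ _ Le (LZ t _ Ld)) Fy.
suff -> : submxcol (e + t *: d) i = submxcol e i + t *: submxcol d i.
  by rewrite !dotE dy mulr0 addr0.
by apply/matrixP => j k; rewrite !mxE.
Qed.

End Products.

Section Feasibility.
Set Implicit Arguments.
Unset Strict Implicit.
Context {R : realType} {n : nat}.
Implicit Types (K L V : set 'cV[R]_n) (c d : 'cV[R]_n) (ds : seq 'cV[R]_n).

Lemma edistance_ge0 V K : (0 <= edistance V K)%E.
Proof. by apply/ereal_infP => _ [z _ <-]; rewrite lee_fin enorm_ge0. Qed.

Lemma not_strongly_infeasibleP K L c : cone K -> linear_subspace L ->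
  ~ strongly_infeasible [set c + u | u in L] K <->
  dual_cone (dual_cone K `&` perp L) c.
Proof.
move=> [K0 KD KZ] sL; have [L0 LD LZ] := sL; split=> [near x [Kx Lx]|Kc].
  rewrite leNgt; apply/negP => cx; apply: near.
  have x0 : 0 < enorm x.
    rewrite lt_def enorm_ge0 andbT; apply/eqP => x0.
    by have := dot_le_enorm (- c) x; rewrite x0 mulr0 dotNl; lra.
  apply: (@lt_le_trans _ _ (- dot c x / enorm x)%:E).
    by rewrite lte_fin divr_gt0 // oppr_gt0.
  apply/ereal_infP => _ [[v k] [[u Lu /= <-] Kk] <-] /=.
  rewrite lee_fin ler_pdivrMr //.
  have := dot_le_enorm (- (c + u - k)) x; rewrite enormN; apply: le_trans.
  have := Kx k Kk; rewrite (dotC x k) !dotE (Lx u Lu); lra.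
move=> far.
pose M := [set x | exists2 u, L u & K (x + u)].
have cM : cone M.
  split=> [|x y [u Lu Ku] [v Lv Kv]|t x t0 [u Lu Ku]].
  - by exists 0; rewrite ?addr0.
  - by exists (u + v); [exact: LD | rewrite addrACA; exact: KD].
  - by exists (t *: u); [exact: LZ | rewrite -scalerDr; exact: KZ].
have [e e0 le] : exists2 e : R, 0 < e & (e%:E <= edistance [set (c + u)%R | u in L] K)%E.
  move: far; rewrite /strongly_infeasible.
  case: (edistance _ _) => [e| |] // e0; first by exists e => //; rewrite -lte_fin.
  by exists 1 => //; rewrite leey.
have [|s Ms sc] := @cone_separation _ _ M c e cM e0.
  move=> y [u Lu Ku]; rewrite -lee_fin; apply: (le_trans le).
  apply: ereal_inf_lbound; exists (c + u, y + u).
    by split=> //; exists u.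
  by rewrite /= opprD addrACA subrr addr0.
have : 0 <= dot c s; last by rewrite dotC; lra.
apply: Kc; split=> [x Kx|u Lu].
  by apply: Ms; exists 0; rewrite ?addr0.
have Ms' v : L v -> 0 <= dot s v.
  move=> Lv; apply: Ms; exists (- v); rewrite ?subrr //.
  exact: linear_subspaceN.
have := Ms' u Lu; have := Ms' (- u) (linear_subspaceN sL Lu).
by rewrite dotNr dotC; lra.
Qed.

Lemma fr_faceE K ds : fr_face K ds = dual_cone K `&` perp [set` <<ds>>%VS].
Proof.
elim/last_ind: ds => [|ds d IH].
  apply/seteqP; split=> [x Kx|x []//]; split=> // u /=.
  by rewrite span_nil memv0 => /eqP ->; rewrite dot0l.
rewrite /fr_face foldl_rcons -/(fr_face K ds) IH; apply/seteqP; split=> x.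
  move=> [[Kx dsx] dx]; split=> // u /=.
  rewrite -cats1 span_cat span_seq1 => /memv_addP[v vds [_ /vlineP[t ->] ->]].
  by rewrite !dotE dx mulr0 addr0 dsx.
move=> [Kx dsx]; split; last first.
  by apply: dsx; rewrite /= memv_span // mem_rcons mem_head.
split=> // u /= uds; apply: dsx => /=.
by rewrite -cats1 span_cat -[u]addr0 memv_add ?mem0v.
Qed.

Lemma fr_face_sub K ds : fr_face K ds `<=` dual_cone K.
Proof. by rewrite fr_faceE => x []. Qed.

End Feasibility.

Section Problem.
Set Implicit Arguments.
Unset Strict Implicit.
Context {R : realType} {m n : nat}.
Variables (K : set 'cV[R]_n) (A : 'M[R]_(m, n)) (c : 'cV[R]_n).
Implicit Types (d : 'cV[R]_n) (ds : seq 'cV[R]_n).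

Lemma linear_subspace_range_adj : linear_subspace (range_adj A).
Proof.
split=> [|_ _ [y _ <-] [z _ <-]|t _ [y _ <-]].
- by exists 0 => //; rewrite mulmx0.
- by exists (y + z) => //; rewrite mulmxDr.
- by exists (t *: y) => //; rewrite -scalemxAr.
Qed.

Lemma perp_range_adj : perp (range_adj A) = [set x | A *m x = 0].
Proof.
have dotA y x : dot (A^T *m y) x = dot y (A *m x).
  by rewrite !dot_mulmx trmx_mul trmxK mulmxA.
apply/seteqP; split=> x /= h.
  by apply: dot_eq0; rewrite -dotA; apply: h; exists (A *m x).
by move=> _ [y _ <-]; rewrite dotA h dot0r.
Qed.

Lemma theta_Pfeas_eq0 :
  theta_Pfeas K A c = 0%E <-> dual_cone (dual_cone K `&` perp (range_adj A)) c.
Proof.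
rewrite perp_range_adj; split=> [h x [Kx Ax]|h].
  have : (theta_Pfeas K A c <= (dot c x)%:E)%E by apply: ereal_inf_lbound; exists x.
  by rewrite h lee_fin.
apply/eqP; rewrite eq_le; apply/andP; split.
  apply: ereal_inf_lbound; exists 0; last by rewrite dot0r.
  by split; [rewrite /= mulmx0 | move=> x _; rewrite dot0l].
by apply/ereal_infP => _ [x [Ax Kx] <-]; rewrite lee_fin; apply: h.
Qed.

Lemma theta_Dhat_eq0 ds y : Dhat_feasible K A c ds y -> theta_Dhat K A c ds = 0%E.
Proof.
move=> Dy; apply/eqP; rewrite eq_le; apply/andP; split.
  by apply/ereal_supP => _ [z _ <-].
by apply: ereal_sup_ubound; exists y.
Qed.

Lemma reducing_directions_rcons ds d : reducing_directions K A ds ->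
  dual_cone (fr_face K ds) d -> range_adj A d ->
  reducing_directions K A (rcons ds d).
Proof.
move=> red Fd Ad i; rewrite size_rcons ltnS leq_eqVlt => /predU1P[->|ids].
  by rewrite nth_rcons ltnn eqxx -cats1 take_size_cat.
rewrite nth_rcons ids -cats1 takel_cat ?(ltnW ids) //; exact: red.
Qed.

Lemma d_str_attained ds : reducing_directions K A ds ->
    restores_strong_duality K A c ds ->
  exists ds', [/\ reducing_directions K A ds', restores_strong_duality K A c ds',
    (size ds')%:R%:E = d_str K A c & (size ds' <= size ds)%N].
Proof.
move=> red res.
pose P k := `[< exists ds, [/\ reducing_directions K A ds,
  restores_strong_duality K A c ds & size ds = k] >].
have Pds : exists k, P k by exists (size ds); apply/asboolP; exists ds.
case: (ex_minnP Pds) => _ /asboolP[ds' [red' res' <-]] minds'.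
exists ds'; split=> //; last by apply: minds'; apply/asboolP; exists ds.
apply/eqP; rewrite eq_le; apply/andP; split.
  apply/ereal_infP => _ [e [rede rese] <-]; rewrite lee_fin ler_nat.
  by apply: minds'; apply/asboolP; exists e.
by apply: ereal_inf_lbound; exists ds'.
Qed.

End Problem.

Section FacialReduction.
Set Implicit Arguments.
Unset Strict Implicit.
Context {R : realType}.

(* As long as the partial polyhedral Slater condition fails, some reducing
   direction cuts a nonpolyhedral block strictly, which lengthens the chain of
   nonpolyhedral faces recorded for that block. *)
Lemma facial_reduction (r m : nat) (p : 'I_r -> nat)
    (Ki : forall i, set 'cV[R]_(p i)) (A : 'M[R]_(m, \sum_(i < r) p i))
    (K := prod_cone Ki) c : (forall i, cone (Ki i)) ->
    dual_cone (dual_cone K `&` perp (range_adj A)) c ->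
  exists ds, [/\ reducing_directions K A ds,
    exists y, Dhat_feasible K A c ds y &
    ((size ds)%:R%:E <= \sum_(i < r) ell_poly (dual_cone (Ki i)))%E].
Proof.
move=> Ki_cone Kc; pose n := (\sum_(i < r) p i)%N.
suff main j (ds : seq 'cV[R]_n) (F : forall i, set 'cV[R]_(p i)) (k : 'I_r -> nat) :
    (n - \dim <<ds>> < j)%N -> reducing_directions K A ds ->
    fr_face K ds = prod_cone F -> (forall i, cone (F i)) ->
    (forall i, face (dual_cone (Ki i)) (F i)) ->
    (forall i, nonpoly_chain (dual_cone (Ki i)) (F i) (k i)) ->
    (size ds <= \sum_(i < r) k i)%N ->
    exists ds, [/\ reducing_directions K A ds,
      exists y, Dhat_feasible K A c ds y &
      ((size ds)%:R%:E <= \sum_(i < r) ell_poly (dual_cone (Ki i)))%E].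
  apply: (main n.+1 [::] (fun i => dual_cone (Ki i)) (fun=> 0%N)) => //.
  - by rewrite span_nil dimv0 subn0.
  - by rewrite /fr_face /= dual_cone_prod // => i; have [] := Ki_cone i.
  - by move=> i; exact: dual_cone_cone.
  - by move=> i; apply/face_refl/dual_cone_cone.
  - by move=> i; exact: nonpoly_chain0.
elim: j ds F k => // j IH ds F k ltj red FE cF fF chF szk.
have F0 i : F i 0 by have [] := cF i.
pose nonpoly_cut d i := ~ polyhedral (F i) /\
  exists2 x, F i x & dot (submxcol d i) x <> 0.
have [[d [Fd Ad] [i0 cut0]]|nex] := pselect (exists2 d,
    dual_cone (fr_face K ds) d /\ range_adj A d & exists i, nonpoly_cut d i); last first.
  exists ds; split=> //; last first.
    apply: (@le_trans _ _ (\sum_(i < r) (k i)%:R%:E)%E).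
      by rewrite sumEFin -natr_sum lee_fin ler_nat.
    apply: lee_sum => i _; apply: nonpoly_chain_ell_poly (chF i) => //.
    exact: dual_cone_cone.
  have [||_ [y _ <-] Fy] := @dual_cone_prod_perp _ _ _ F (range_adj A) c cF
    (linear_subspace_range_adj A); last by exists y; rewrite /Dhat_feasible /= FE.
    move=> i; have [pF|nF] := pselect (polyhedral (F i)); [by left|right].
    move=> d y; rewrite -FE => Fd Ad Fy; apply: contrapT => dy; apply: nex.
    by exists d => //; exists i; split=> //; exists y.
  by rewrite -FE => x [/fr_face_sub Kx Ax]; apply: Kc.
have dF : fr_face K (rcons ds d) = prod_cone (fun i => F i `&` orth (submxcol d i)).
  by rewrite /fr_face foldl_rcons -/(fr_face K ds) FE prod_cone_orth // -FE.
have Fdi i : dual_cone (F i) (submxcol d i).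
  by move: Fd; rewrite FE dual_cone_prod // => /(_ i).
apply: (IH (rcons ds d) (fun i => F i `&` orth (submxcol d i))
  (fun i => (k i + `[< nonpoly_cut d i >])%N)) => //.
- rewrite -ltnS (leq_trans _ ltj) // ltnS -cats1 span_cat span_seq1.
  apply: codim_addv_line; apply/negP => dds; case: cut0 => _ [x Fx]; apply.
  apply/eqP; rewrite eq_le Fdi // andbT leNgt; apply/negP => dx.
  pose f := dfwith (fun l => 0 : 'cV[R]_(p l)) i0 x.
  have : fr_face K ds (\mxcol_l f l).
    rewrite FE => l; rewrite mxcolK /f.
    have [<-|il] := eqVneq i0 l; first by rewrite dfwithin.
    by rewrite dfwithout.
  rewrite fr_faceE => -[_ /(_ d dds)]; rewrite dot_submxcol (bigD1 i0) //= big1.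
    by rewrite mxcolK /f dfwithin addr0; lra.
  by move=> l li; rewrite mxcolK /f dfwithout ?dot0r // eq_sym.
- exact: reducing_directions_rcons.
- by move=> i; exact: cone_orth.
- by move=> i; exact: face_orth.
- move=> i; have sFF : F i `&` orth (submxcol d i) `<=` F i by move=> x [].
  case: asboolP => [[nF [x Fx dx]]|_]; last first.
    by rewrite addn0; apply: nonpoly_chain_sub (chF i).
  rewrite addn1; apply: nonpoly_chainS (chF i) => //.
  by split=> // /(_ x Fx)[].
- rewrite size_rcons big_split /= -addn1 leq_add // (bigD1 i0) //=.
  by case: asboolP.
Qed.

End FacialReduction.

Theorem theorem17 (R : realType) (r m : nat) (p : 'I_r -> nat)
    (Ki : forall i : 'I_r, set 'cV[R]_(p i))
    (Ki_ccc : forall i : 'I_r, closed_convex_cone (Ki i))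
    (A : 'M[R]_(m, \sum_(i < r) p i))
    (b : 'cV[R]_m) (c : 'cV[R]_(\sum_(i < r) p i)) :
  let K := prod_cone Ki in
  (~ D_strongly_infeasible K A c <->
     exists ds : seq 'cV[R]_(\sum_(i < r) p i),
       [/\ reducing_directions K A ds,
           restores_strong_duality K A c ds,
           (size ds)%:R%:E = d_str K A c &
           exists yhat : 'cV[R]_m,
             dual_cone (fr_face K ds) (c - A^T *m yhat)])
  /\
  (~ D_strongly_infeasible K A c ->
     exists (a : 'cV[R]_(\sum_(i < r) p i))
            (L : {vspace 'cV[R]_(\sum_(i < r) p i)}),
       let V' := affine_subspace a L in
       [/\ V' `<=` [set c - u | u in range_adj A],
           ~ strongly_infeasible V' K,
           ((\dim L)%:R%:E <= d_str K A c)%E,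
           (d_str K A c <= \sum_(i < r) ell_poly (dual_cone (Ki i)))%E &
           D_weakly_infeasible K A c -> weakly_infeasible V' K]).
Proof.
move=> K.
have cKi i : cone (Ki i) by have [_] := Ki_ccc i.
have cK : cone K by exact: cone_prod.
have sL := linear_subspace_range_adj A; have [L0 LD LZ] := sL.
have nSI := not_strongly_infeasibleP c cK sL.
have fwd : ~ D_strongly_infeasible K A c -> exists ds,
    [/\ reducing_directions K A ds, restores_strong_duality K A c ds,
        (size ds)%:R%:E = d_str K A c,
        ((size ds)%:R%:E <= \sum_(i < r) ell_poly (dual_cone (Ki i)))%E &
        exists y, Dhat_feasible K A c ds y].
  move=> /nSI Kc; have theta0 := (theta_Pfeas_eq0 K A c).2 Kc.
  have [ds [red [y Dy] szds]] := facial_reduction cKi Kc.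
  have res : restores_strong_duality K A c ds.
    by split=> [|_]; [rewrite theta0 | exists y => //]; rewrite (theta_Dhat_eq0 Dy).
  have [ds' [red' res' min' le']] := d_str_attained red res.
  exists ds'; split=> //; first by rewrite (le_trans _ szds) // lee_fin ler_nat.
  have [_] := res'; rewrite theta0 ltNy0 lt0y => /(_ isT)[z Dz _]; by exists z.
split; first split.
- by move=> /fwd[ds [red res min _ [y Dy]]]; exists ds; split=> //; exists y.
- move=> [ds [_ [res _] _ [y Dy]]]; apply/nSI/theta_Pfeas_eq0.
  by rewrite res (theta_Dhat_eq0 Dy).
move=> /fwd[ds [red res min le [y Dy]]].
have sds : linear_subspace [set` <<ds>>%VS].
  split=> [|u v uds vds|t u uds] /=; rewrite ?mem0v //; first exact: memvD.
  exact: memvZ.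
have dsL u : u \in <<ds>>%VS -> range_adj A u.
  move=> /(@coord_span _ _ _ (in_tuple ds)) ->.
  apply: (big_ind (range_adj A)) => // i _; apply: LZ.
  by have [] := red i (ltn_ord i).
have sub : affine_subspace (c - A^T *m y) <<ds>>%VS `<=` [set c - u | u in range_adj A].
  move=> _ [u /= uds <-]; exists (A^T *m y - u); last by rewrite opprB addrA addrAC.
  by apply: LD; [exists y | apply: linear_subspaceN => //; exact: dsL].
have near : ~ strongly_infeasible (affine_subspace (c - A^T *m y) <<ds>>%VS) K.
  by apply/(not_strongly_infeasibleP _ cK sds); rewrite -fr_faceE.
exists (c - A^T *m y), <<ds>>%VS; split=> //.
- by rewrite -min lee_fin ler_nat dim_span.
- by rewrite -min.
move=> [disj _]; split.
  apply/seteqP; split=> // x [/sub[u Lu xE] Kx].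
  suff : ([set c + u | u in range_adj A] `&` K) x by rewrite disj.
  by split=> //; exists (- u) => //; exact: linear_subspaceN.
apply/eqP; rewrite eq_le edistance_ge0 andbT leNgt; exact/negP.
Qed.
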